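(* Let $\mu>0$ and let $X$ be a non-negative real random variable with mean $\mathrm{E}[X]=\mu$ such that $\mathrm{E}[\exp(tX)]\le \exp(\mu(e^t-1))$ for all $t>0$. Then for all real $k>0$ and any real $\alpha>0$, $$\mathrm{E}\left[(X/\mu)^k\right]\le\left(\frac{k/\mu}{e^{1-\alpha}\log(1+\alpha k/\mu)}\right)^k.$$
   Context: $\log$ denotes the natural logarithm. *)

(* Defs.v *)
From mathcomp Require Import all_boot all_order all_algebra.
From mathcomp Require Import all_classical all_reals all_analysis.

(* Main.v *)
Require Import Defs.
From mathcomp Require Import all_boot all_order all_algebra.
From mathcomp Require Import all_classical all_reals all_analysis.
From mathcomp Require Import measurable_realfun ring.
Import Order.TTheory GRing.Theory Num.Theory.
Import numFieldNormedType.Exports.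
Local Open Scope ring_scope.

(** Chernoff-style argument for moments. A power is dominated by an exponential:
    x ^ k <= (k / (e t)) ^ k * e ^ (t x) for x >= 0 and t > 0 ([powR_le_expR]), so
    every moment of a nonnegative variable is controlled by its moment generating
    function at any single t > 0 ([expectation_powR_le_mgf]). Under the Poisson bound on the
    generating function this gives
      E [(X / mu) ^ k] <= (k / (e mu t)) ^ k * exp (mu (e ^ t - 1)),
    and t := log (1 + alpha k / mu) turns the last factor into
    exp (alpha k) = (e ^ alpha) ^ k, which merges with the k-th power. *)

(** The k-th power of [y <= exp (y - 1)] at [y = t x / k]; equality holds at
    [x = k / t], so the constant is optimal. *)
Lemma powR_le_expR (R : realType) (k t x : R) :
  0 < k -> 0 < t -> 0 <= x ->
  x `^ k <= (k / (expR 1 * t)) `^ k * expR (t * x).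
Proof.
move=> k0 t0 x0.
have C0 : 0 <= k / (expR 1 * t).
  by rewrite divr_ge0 ?mulr_ge0 ?expR_ge0 // ltW.
have -> : t * x = t * x / k * k by rewrite mulfVK // gt_eqF.
rewrite expRM -powRM ?expR_ge0 //.
apply: ge0_ler_powR; rewrite ?nnegrE ?(ltW k0) ?(mulr_ge0 C0) ?expR_ge0 //.
have -> : expR (t * x / k) = expR 1 * expR (t * x / k - 1).
  by rewrite -expRD addrC subrK.
have -> : k / (expR 1 * t) * (expR 1 * expR (t * x / k - 1)) =
          k / t * expR (t * x / k - 1).
  by field; rewrite !gt_eqF ?expR_gt0.
rewrite -ler_pdivrMl ?divr_gt0 // invf_div mulrAC.
by have := expR_ge1Dx (t * x / k - 1); rewrite addrC subrK.
Qed.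

Lemma expectation_powR_le_mgf (R : realType) (d : measure_display)
  (T : measurableType d) (P : probability T R) (Y : T -> R) (k t : R) :
  measurable_fun setT Y -> {ae P, forall w, 0 <= Y w} -> 0 < k -> 0 < t ->
  ('E_P[fun w => (Y w `^ k)%R] <=
    ((k / (expR 1 * t)) `^ k)%:E * 'E_P[fun w => expR (t * Y w)%R])%E.
Proof.
move=> mY Y0 k0 t0; rewrite unlock.
have mexp : measurable_fun setT (fun w => expR (t * Y w)).
  by apply: measurableT_comp => //; exact: measurable_funM.
rewrite -ge0_integralZl //; last 2 first.
- exact/measurable_EFinP.
- by rewrite lee_fin powR_ge0.
apply: ae_ge0_le_integral => //.
- by move=> w _; rewrite lee_fin powR_ge0.
- apply/measurable_EFinP.
  exact: (measurableT_comp (measurable_powR k) mY).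
- by move=> w _; rewrite -EFinM lee_fin mulr_ge0 ?powR_ge0 ?expR_ge0.
- by apply: measurable_funeM; exact/measurable_EFinP.
apply: filterS Y0 => w Yw0 _.
by rewrite -EFinM lee_fin powR_le_expR.
Qed.

Theorem theorem1 (R : realType) (d : measure_display) (T : measurableType d)
  (P : probability T R) (X : {RV P >-> R}) (mu : R)
  (mu_gt0 : 0 < mu)
  (X_ge0 : {ae P, forall w, 0 <= X w})
  (X_mean : ('E_P[X] = mu%:E)%E)
  (X_mgf : forall t : R, 0 < t ->
    ('E_P[fun w => expR (t * X w)%R] <= (expR (mu * (expR t - 1))%R)%:E)%E)
  (k alpha : R) (k_gt0 : 0 < k) (alpha_gt0 : 0 < alpha) :
  ('E_P[fun w => ((X w / mu) `^ k)%R] <=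
    (((k / mu) / (expR (1 - alpha) * ln (1 + alpha * k / mu))) `^ k)%:E)%E.
Proof.
have c_gt0 : 0 < alpha * k / mu by rewrite divr_gt0 ?mulr_gt0.
set t := ln (1 + alpha * k / mu).
have t_gt0 : 0 < t by rewrite ln_gt0 // ltrDl.
have mY : measurable_fun setT (fun w => X w / mu) by exact: measurable_funM.
have Y_ge0 : {ae P, forall w, 0 <= X w / mu}.
  by apply: filterS X_ge0 => w Xw0; rewrite divr_ge0 // ltW.
(* The exponent [mu * t] is the one for which the generating function of
   [X / mu] becomes that of [X] at [t]. *)
apply: (le_trans (expectation_powR_le_mgf _ _ _ P _ _ _ mY Y_ge0 k_gt0
                    (mulr_gt0 mu_gt0 t_gt0))).
have -> : (fun w => expR (mu * t * (X w / mu))) = (fun w => expR (t * X w)).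
  by apply/funext => w; congr expR; field; rewrite gt_eqF.
apply: (le_trans (lee_wpmul2l _ (X_mgf _ t_gt0))).
  by rewrite lee_fin powR_ge0.
have -> : mu * (expR t - 1) = alpha * k.
  rewrite lnK; last by rewrite posrE addr_gt0.
  by field; rewrite gt_eqF.
rewrite -EFinM lee_fin expRM -powRM ?expR_ge0 //; last first.
  by rewrite divr_ge0 ?mulr_ge0 ?expR_ge0 // ltW.
rewrite le_eqVlt; apply/orP; left; apply/eqP; congr (_ `^ _).
rewrite expRD expRN.
by field; rewrite !gt_eqF ?expR_gt0.
Qed.
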